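(* Let $K$ be a field and let $E$ and $F$ be row-finite graphs such that there exists a ring isomorphism $\varphi:L_K(E)\to L_K(F)$. Suppose that $\mathrm{HS}_E=1=\mathrm{HS}_F$ and let $I$ and $J$ be the only nontrivial graded ideals of $L_K(E)$ and $L_K(F)$, respectively. Then $J=\varphi(I)$ and $L_K(E)/I\cong L_K(F)/J$ (as rings).
   Context: A (directed) graph $E=(E^0,E^1,r,s)$ consists of sets $E^0$ (vertices), $E^1$ (edges) and maps $r,s:E^1\to E^0$ (range, source); it is row-finite if $s^{-1}(v)$ is finite for every $v\in E^0$. A sink is a vertex emitting no edges. A path is a vertex (length $0$) or a finite sequence of edges $e_1\cdots e_n$ with $r(e_i)=s(e_{i+1})$ (length $n$). The Leavitt path algebra $L_K(E)$ is the $K$-algebra generated by $E^0\cup E^1\cup\{e^*\mid e\in E^1\}$ with relations: $vw=\delta_{v,w}v$ for $v,w\in E^0$; $s(e)e=er(e)=e$ and $r(e)e^*=e^*s(e)=e^*$ for $e\in E^1$; $e^*f=\delta_{e,f}r(e)$ for $e,f\in E^1$; $v=\sum_{e\in s^{-1}(v)}ee^*$ for every $v\in E^0$ that is not a sink. It is $\mathbb Z$-graded, with degree $n$ component spanned by the elements $pq^*$ with $p,q$ paths, $l(p)-l(q)=n$, where $(e_1\cdots e_n)^*=e_n^*\cdots e_1^*$ and $v^*=v$. Write $v\ge w$ if there is a path from $v$ to $w$. $H\subseteq E^0$ is hereditary if $v\in H$, $v\ge w$ imply $w\in H$; saturated if $s^{-1}(v)\ne\emptyset$ finite and $r(s^{-1}(v))\subseteq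 H$ imply $v\in H$. $\mathcal H_E$ is the set of hereditary saturated subsets of $E^0$, and $\mathrm{HS}_E:=|\mathcal H_E|-2$. For row-finite $E$ there is a (known) lattice isomorphism between $\mathcal H_E$ and the lattice of graded ideals of $L_K(E)$, so $\mathrm{HS}_E=1$ means that $L_K(E)$ has exactly one graded ideal that is nontrivial, i.e. different from $0$ and $L_K(E)$. *)

(* Defs.v *)
From HB Require Import structures.
From mathcomp Require Import all_boot all_order all_algebra finmap.
From mathcomp Require Import generic_quotient ring_quotient.
From mathcomp Require Import boolp classical_sets functions cardinality.

Set Implicit Arguments.
Unset Strict Implicit.
Unset Printing Implicit Defensive.
Import GRing.Theory.
Local Open Scope classical_set_scope.
Local Open Scope ring_scope.
Local Open Scope quotient_scope.

(* Rings without unit: L_K(E) has no identity when E has infinitely many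
   vertices.  The product is the one of the underlying semigroup, written
   (x * y)%g.                                                               *)
HB.mixin Record SemigroupZmodule_isRng R of GRing.Zmodule R & Semigroup R := {
  rngDl : forall x y z : R, ((x + y)%R * z)%g = ((x * z)%g + (y * z)%g)%R;
  rngDr : forall x y z : R, (x * (y + z)%R)%g = ((x * y)%g + (x * z)%g)%R
}.
#[short(type="rngType")]
HB.structure Definition Rng :=
  {R of SemigroupZmodule_isRng R & GRing.Zmodule R & Semigroup R}.

HB.mixin Record LmoduleRng_isNAlgebra (K : pzRingType) A
    of GRing.Lmodule K A & Rng A := {
  nscaleAl : forall (k : K) (x y : A), k *: (x * y)%g = ((k *: x)%R * y)%g;
  nscaleAr : forall (k : K) (x y : A), k *: (x * y)%g = (x * (k *: y)%R)%g
}.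
#[short(type="nalgType")]
HB.structure Definition NAlgebra (K : pzRingType) :=
  {A of LmoduleRng_isNAlgebra K A & GRing.Lmodule K A & Rng A}.

Definition rng_morphism (A B : rngType) (f : A -> B) : Prop :=
  {morph f : x y / x + y} /\ {morph f : x y / (x * y)%g}.

Definition rng_iso (A B : rngType) (f : A -> B) : Prop :=
  rng_morphism f /\ bijective f.

Definition rng_isomorphic (A B : rngType) : Prop :=
  exists f : A -> B, rng_iso f.

(* Two-sided ideals of a rng, and the rng structure on R / I = {quot I}. *)
HB.mixin Record isRngIdeal (R : rngType) (I : {pred R}) := {
  rng_idealMl : forall x y : R, y \in I -> (x * y)%g \in I;
  rng_idealMr : forall x y : R, x \in I -> (x * y)%g \in I
}.
#[short(type="rng_ideal")]
HB.structure Definition RngIdeal (R : rngType) :=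
  {I of GRing.ZmodClosed R I & isRngIdeal R I}.

Section RngQuotient.
Variables (R : rngType) (I : rng_ideal R).
Local Notation Q := {ideal_quot I}.

Definition rquot_mul : Q -> Q -> Q := lift_op2 Q *%g.

Lemma rngN (x y : R) : ((- x) * y)%g = - (x * y)%g /\ (x * (- y))%g = - (x * y)%g.
Proof.
have z0 z : (0%R * z)%g = 0 :> R.
  by apply: (@addrI _ (0 * z)%g); rewrite -rngDl !addr0.
have z1 z : (z * 0%R)%g = 0 :> R.
  by apply: (@addrI _ (z * 0)%g); rewrite -rngDr !addr0.
split; apply: (@addrI _ (x * y)%g); rewrite subrr.
  by rewrite -rngDl subrr z0.
by rewrite -rngDr subrr z1.
Qed.

Lemma rquot_mulE (x y : R) : rquot_mul (\pi_Q x) (\pi_Q y) = \pi_Q (x * y)%g.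
Proof.
unlock rquot_mul; apply/eqP; rewrite -Quotient.idealrBE.
set x' := repr _; set y' := repr _.
have Ix : x' - x \in I by rewrite Quotient.idealrBE /x' reprK.
have Iy : y' - y \in I by rewrite Quotient.idealrBE /y' reprK.
have -> : (x' * y')%g - (x * y)%g = ((x' - x) * y')%g + (x * (y' - y))%g.
  by rewrite rngDl rngDr (rngN x y').1 (rngN x y).2 addrA addrNK.
apply: rpredD; [exact: rng_idealMr | exact: rng_idealMl].
Qed.

Let rquot_mulA : associative rquot_mul.
Proof.
elim/quotW=> x; elim/quotW=> y; elim/quotW=> z.
by rewrite !rquot_mulE mulgA.
Qed.

HB.instance Definition _ := hasMul.Build Q rquot_mul.
HB.instance Definition _ := Magma_isSemigroup.Build Q rquot_mulA.

Lemma rquotD (x y : R) : \pi_Q (x + y) = (\pi_Q x + \pi_Q y)%R.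
Proof. exact: (Quotient.pi_add I). Qed.

Lemma rquotM (x y : R) : \pi_Q (x * y)%g = (\pi_Q x * \pi_Q y)%g.
Proof. exact/esym/rquot_mulE. Qed.

Let rquot_mulDl (x y z : Q) : ((x + y)%R * z)%g = ((x * z)%g + (y * z)%g)%R.
Proof.
elim/quotW: x => x; elim/quotW: y => y; elim/quotW: z => z.
by rewrite -!rquotD -!rquotM -rquotD rngDl.
Qed.

Let rquot_mulDr (x y z : Q) : (x * (y + z)%R)%g = ((x * y)%g + (x * z)%g)%R.
Proof.
elim/quotW: x => x; elim/quotW: y => y; elim/quotW: z => z.
by rewrite -!rquotD -!rquotM -rquotD rngDr.
Qed.

HB.instance Definition _ := SemigroupZmodule_isRng.Build Q rquot_mulDl rquot_mulDr.

End RngQuotient.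

(* Leibniz equality is decidable on a choiceType; classically every set can
   be given such a structure, so the graphs below are arbitrary.            *)
Record graph := Graph {
  vertex : choiceType;
  edge : choiceType;
  esrc : edge -> vertex;
  etgt : edge -> vertex
}.

Section Graphs.
Variable E : graph.
Implicit Types (v w : vertex E) (e : edge E) (H : set (vertex E)).

Definition emitted v : set (edge E) := [set e | esrc e = v].

Definition row_finite : Prop := forall v, finite_set (emitted v).

Definition sink v : Prop := emitted v = set0.

(* A path is given by its source v and its edges es; the source matters only
   when es is empty, that is for the path v of length 0.                    *)
Fixpoint is_path v (es : seq (edge E)) : bool :=
  if es is e :: es' then (esrc e == v) && is_path (etgt e) es' else true.

Definition path_end v (es : seq (edge E)) : vertex E :=
  last v (map (@etgt E) es).

Definition reaches v w : Prop := exists2 es, is_path v es & path_end v es = w.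

Definition hereditary H : Prop := forall v w, H v -> reaches v w -> H w.

Definition saturated H : Prop :=
  forall v, emitted v !=set0 -> finite_set (emitted v) ->
    (@etgt E) @` emitted v `<=` H -> H v.

Definition HerSat : set (set (vertex E)) :=
  [set H | hereditary H /\ saturated H].

(* When HerSat is infinite, fset_set HerSat is empty and HS takes the junk
   value -2, which no finite HerSat yields since it always contains setT.   *)
Definition HS : int := #|` fset_set HerSat|%:Z - 2.

End Graphs.

Section LeavittPathAlgebra.
Variables (K : fieldType) (E : graph).

Inductive lpa_term : Type :=
  | Tvertex of vertex E
  | Tedge of edge E
  | Tghost of edge E
  | Tzero
  | Topp of lpa_term
  | Tadd of lpa_term & lpa_term
  | Tmul of lpa_term & lpa_term
  | Tscale of K & lpa_term.

Definition Tsum (ts : seq lpa_term) : lpa_term := foldr Tadd Tzero ts.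

(* The congruence generated by the axioms of associative K-algebras and the
   defining relations of L_K(E).                                            *)
Inductive lpa_eqv : lpa_term -> lpa_term -> Prop :=
  | Erefl t : lpa_eqv t t
  | Esym t u : lpa_eqv t u -> lpa_eqv u t
  | Etrans t u w : lpa_eqv t u -> lpa_eqv u w -> lpa_eqv t w
  | Eopp t t' : lpa_eqv t t' -> lpa_eqv (Topp t) (Topp t')
  | Eadd t t' u u' : lpa_eqv t t' -> lpa_eqv u u' ->
      lpa_eqv (Tadd t u) (Tadd t' u')
  | Emul t t' u u' : lpa_eqv t t' -> lpa_eqv u u' ->
      lpa_eqv (Tmul t u) (Tmul t' u')
  | Escale k t t' : lpa_eqv t t' -> lpa_eqv (Tscale k t) (Tscale k t')
  | EaddA t u w : lpa_eqv (Tadd t (Tadd u w)) (Tadd (Tadd t u) w)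
  | EaddC t u : lpa_eqv (Tadd t u) (Tadd u t)
  | Eadd0 t : lpa_eqv (Tadd Tzero t) t
  | EaddN t : lpa_eqv (Tadd (Topp t) t) Tzero
  | EmulA t u w : lpa_eqv (Tmul t (Tmul u w)) (Tmul (Tmul t u) w)
  | EmulDl t u w : lpa_eqv (Tmul (Tadd t u) w) (Tadd (Tmul t w) (Tmul u w))
  | EmulDr t u w : lpa_eqv (Tmul t (Tadd u w)) (Tadd (Tmul t u) (Tmul t w))
  | EscaleA k l t : lpa_eqv (Tscale k (Tscale l t)) (Tscale (k * l) t)
  | Escale1 t : lpa_eqv (Tscale 1 t) t
  | EscaleDr k t u :
      lpa_eqv (Tscale k (Tadd t u)) (Tadd (Tscale k t) (Tscale k u))
  | EscaleDl k l t :
      lpa_eqv (Tscale (k + l) t) (Tadd (Tscale k t) (Tscale l t))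
  | EscaleAl k t u : lpa_eqv (Tscale k (Tmul t u)) (Tmul (Tscale k t) u)
  | EscaleAr k t u : lpa_eqv (Tscale k (Tmul t u)) (Tmul t (Tscale k u))
  | Evv v w :
      lpa_eqv (Tmul (Tvertex v) (Tvertex w)) (if v == w then Tvertex v else Tzero)
  | Ese e : lpa_eqv (Tmul (Tvertex (esrc e)) (Tedge e)) (Tedge e)
  | Eer e : lpa_eqv (Tmul (Tedge e) (Tvertex (etgt e))) (Tedge e)
  | Erg e : lpa_eqv (Tmul (Tvertex (etgt e)) (Tghost e)) (Tghost e)
  | Egs e : lpa_eqv (Tmul (Tghost e) (Tvertex (esrc e))) (Tghost e)
  | ECK1 e f :
      lpa_eqv (Tmul (Tghost e) (Tedge f)) (if e == f then Tvertex (etgt e) else Tzero)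
  | ECK2 v : ~ sink v -> finite_set (emitted v) ->
      lpa_eqv (Tvertex v)
        (Tsum [seq Tmul (Tedge e) (Tghost e) | e <- fset_set (emitted v)]).

HB.instance Definition _ := gen_eqMixin lpa_term.
HB.instance Definition _ := gen_choiceMixin lpa_term.

Definition lpa_eqb (t u : lpa_term) : bool := `[< lpa_eqv t u >].

Lemma lpa_eqb_equiv : equiv_class_of lpa_eqb.
Proof.
split=> [t|t u|u t w].
- exact/asboolP/Erefl.
- by apply/asboolP/asboolP; apply: Esym.
- by move=> /asboolP tu /asboolP uw; apply/asboolP/(Etrans tu).
Qed.

Canonical lpa_equivRel := EquivRelPack lpa_eqb_equiv.
Canonical lpa_encModRel := defaultEncModRel lpa_eqb.

Definition lpa : Type := {eq_quot lpa_eqb}.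

HB.instance Definition _ := Choice.on lpa.
HB.instance Definition _ : EqQuotient lpa_term lpa_eqb lpa := EqQuotient.on lpa.

Definition lpa_class (t : lpa_term) : lpa := \pi_lpa t.

Lemma lpa_classP t u : lpa_class t = lpa_class u <-> lpa_eqv t u.
Proof.
split=> [/eqP|tu]; first by rewrite /lpa_class eqmodE => /asboolP.
by apply/eqP; rewrite /lpa_class eqmodE; apply/asboolP.
Qed.

Lemma lpa_repr t : lpa_eqv (repr (lpa_class t)) t.
Proof. by apply/lpa_classP; rewrite /lpa_class reprK. Qed.

Lemma lpa_ind (P : lpa -> Prop) : (forall t, P (lpa_class t)) -> forall x, P x.
Proof. by move=> Pt x; rewrite -[x]reprK; apply: Pt. Qed.

Definition lpa_add : lpa -> lpa -> lpa := lift_op2 lpa Tadd.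
Definition lpa_opp : lpa -> lpa := lift_op1 lpa Topp.
Definition lpa_mul : lpa -> lpa -> lpa := lift_op2 lpa Tmul.
Definition lpa_scale (k : K) : lpa -> lpa := lift_op1 lpa (Tscale k).

Lemma lpa_addE t u : lpa_add (lpa_class t) (lpa_class u) = lpa_class (Tadd t u).
Proof. by unlock lpa_add; apply/lpa_classP; apply: Eadd; apply: lpa_repr. Qed.
Lemma lpa_oppE t : lpa_opp (lpa_class t) = lpa_class (Topp t).
Proof. by unlock lpa_opp; apply/lpa_classP; apply: Eopp; apply: lpa_repr. Qed.
Lemma lpa_mulE t u : lpa_mul (lpa_class t) (lpa_class u) = lpa_class (Tmul t u).
Proof. by unlock lpa_mul; apply/lpa_classP; apply: Emul; apply: lpa_repr. Qed.
Lemma lpa_scaleE k t : lpa_scale k (lpa_class t) = lpa_class (Tscale k t).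
Proof. by unlock lpa_scale; apply/lpa_classP; apply: Escale; apply: lpa_repr. Qed.
Definition lpaE := (lpa_addE, lpa_oppE, lpa_mulE, lpa_scaleE).

Let addA : associative lpa_add.
Proof.
elim/lpa_ind=> t; elim/lpa_ind=> u; elim/lpa_ind=> w.
by rewrite !lpaE; apply/lpa_classP/EaddA.
Qed.
Let addC : commutative lpa_add.
Proof.
elim/lpa_ind=> t; elim/lpa_ind=> u.
by rewrite !lpaE; apply/lpa_classP/EaddC.
Qed.
Let add0 : left_id (lpa_class Tzero) lpa_add.
Proof. by elim/lpa_ind=> t; rewrite !lpaE; apply/lpa_classP/Eadd0. Qed.
Let addN : left_inverse (lpa_class Tzero) lpa_opp lpa_add.
Proof. by elim/lpa_ind=> t; rewrite !lpaE; apply/lpa_classP/EaddN. Qed.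

HB.instance Definition _ := GRing.isZmodule.Build lpa addA addC add0 addN.

Let scaleA k l x : lpa_scale k (lpa_scale l x) = lpa_scale (k * l) x.
Proof. by elim/lpa_ind: x => t; rewrite !lpaE; apply/lpa_classP/EscaleA. Qed.
Let scale1 : left_id 1 lpa_scale.
Proof. by elim/lpa_ind=> t; rewrite !lpaE; apply/lpa_classP/Escale1. Qed.
Let scaleDr : right_distributive lpa_scale +%R.
Proof.
move=> k; elim/lpa_ind=> t; elim/lpa_ind=> u.
by rewrite /+%R /= !lpaE; apply/lpa_classP/EscaleDr.
Qed.
Let scaleDl x : {morph lpa_scale^~ x : k l / k + l}.
Proof.
move=> k l; elim/lpa_ind: x => t.
by rewrite [RHS]/(_ + _) /= !lpaE; apply/lpa_classP/EscaleDl.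
Qed.

HB.instance Definition _ :=
  GRing.Zmodule_isLmodule.Build K lpa scaleA scale1 scaleDr scaleDl.

Let mulA : associative lpa_mul.
Proof.
elim/lpa_ind=> t; elim/lpa_ind=> u; elim/lpa_ind=> w.
by rewrite !lpaE; apply/lpa_classP/EmulA.
Qed.

HB.instance Definition _ := hasMul.Build lpa lpa_mul.
HB.instance Definition _ := Magma_isSemigroup.Build lpa mulA.

Let mulDl (x y z : lpa) : ((x + y)%R * z)%g = ((x * z)%g + (y * z)%g)%R.
Proof.
elim/lpa_ind: x => t; elim/lpa_ind: y => u; elim/lpa_ind: z => w.
by rewrite /monoid.mul /+%R /= !lpaE; apply/lpa_classP/EmulDl.
Qed.
Let mulDr (x y z : lpa) : (x * (y + z)%R)%g = ((x * y)%g + (x * z)%g)%R.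
Proof.
elim/lpa_ind: x => t; elim/lpa_ind: y => u; elim/lpa_ind: z => w.
by rewrite /monoid.mul /+%R /= !lpaE; apply/lpa_classP/EmulDr.
Qed.

HB.instance Definition _ := SemigroupZmodule_isRng.Build lpa mulDl mulDr.

Let scaleAl k (x y : lpa) : k *: (x * y)%g = ((k *: x)%R * y)%g.
Proof.
elim/lpa_ind: x => t; elim/lpa_ind: y => u.
by rewrite /monoid.mul /GRing.scale /= !lpaE; apply/lpa_classP/EscaleAl.
Qed.
Let scaleAr k (x y : lpa) : k *: (x * y)%g = (x * (k *: y)%R)%g.
Proof.
elim/lpa_ind: x => t; elim/lpa_ind: y => u.
by rewrite /monoid.mul /GRing.scale /= !lpaE; apply/lpa_classP/EscaleAr.
Qed.

HB.instance Definition _ := LmoduleRng_isNAlgebra.Build K lpa scaleAl scaleAr.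

Lemma lpa_classD t u : lpa_class (Tadd t u) = lpa_class t + lpa_class u.
Proof. exact/esym/lpa_addE. Qed.
Lemma lpa_classN t : lpa_class (Topp t) = - lpa_class t.
Proof. exact/esym/lpa_oppE. Qed.
Lemma lpa_classM t u : lpa_class (Tmul t u) = (lpa_class t * lpa_class u)%g.
Proof. exact/esym/lpa_mulE. Qed.
Lemma lpa_classZ k t : lpa_class (Tscale k t) = k *: lpa_class t.
Proof. exact/esym/lpa_scaleE. Qed.
Lemma lpa_class_sum ts : lpa_class (Tsum ts) = \sum_(t <- ts) lpa_class t.
Proof. by elim: ts => [|t ts IH]; rewrite ?big_nil // big_cons -IH -lpa_classD. Qed.

Definition lpa_vertex (v : vertex E) : lpa := lpa_class (Tvertex v).
Definition lpa_edge (e : edge E) : lpa := lpa_class (Tedge e).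
Definition lpa_ghost (e : edge E) : lpa := lpa_class (Tghost e).

(* The images in lpa of the path p = (v, es) and of its ghost p*. *)
Definition lpa_path (v : vertex E) (es : seq (edge E)) : lpa :=
  if es is e :: es' then foldl (fun x f => (x * lpa_edge f)%g) (lpa_edge e) es'
  else lpa_vertex v.

Definition lpa_ghost_path (v : vertex E) (es : seq (edge E)) : lpa :=
  if es is e :: es' then foldl (fun x f => (lpa_ghost f * x)%g) (lpa_ghost e) es'
  else lpa_vertex v.

Definition is_monomial (n : int) (x : lpa) : Prop :=
  exists v es w fs, [/\ is_path v es, is_path w fs,
    (size es)%:Z - (size fs)%:Z = n & x = (lpa_path v es * lpa_ghost_path w fs)%g].

Definition lpa_component (n : int) : set lpa :=
  [set x | exists (m : nat) (k : 'I_m -> K) (y : 'I_m -> lpa),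
    (forall i, is_monomial n (y i)) /\ x = \sum_i k i *: y i].

(* I is the sum of its intersections with the homogeneous components. *)
Definition graded_ideal (I : rng_ideal lpa) : Prop :=
  forall x, x \in I -> exists (m : nat) (d : 'I_m -> int) (y : 'I_m -> lpa),
    (forall i, lpa_component (d i) (y i) /\ y i \in I) /\ x = \sum_i y i.

Definition nontrivial_graded_ideal (I : rng_ideal lpa) : Prop :=
  [/\ graded_ideal I, [set` I] <> [set 0] & [set` I] <> setT].

End LeavittPathAlgebra.

Section UniversalProperty.
Variables (K : fieldType) (E : graph).

Definition leavitt_family (A : nalgType K)
    (av : vertex E -> A) (ae ag : edge E -> A) : Prop :=
  [/\ forall v w, (av v * av w)%g = if v == w then av v else 0,
      forall e, (av (esrc e) * ae e)%g = ae e /\ (ae e * av (etgt e))%g = ae e,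
      forall e, (av (etgt e) * ag e)%g = ag e /\ (ag e * av (esrc e))%g = ag e,
      forall e f, (ag e * ae f)%g = if e == f then av (etgt e) else 0 &
      forall v, ~ sink v -> finite_set (emitted v) ->
        av v = \sum_(e <- fset_set (emitted v)) (ae e * ag e)%g].

Lemma lpa_leavitt_family :
  leavitt_family (@lpa_vertex K E) (@lpa_edge K E) (@lpa_ghost K E).
Proof.
split=> [v w|e|e|e f|v nsv fv]; rewrite -?lpa_classM.
- by apply: etrans; [apply/lpa_classP/Evv | case: ifP].
- by rewrite -?lpa_classM; split; apply/lpa_classP; [apply: Ese | apply: Eer].
- by rewrite -?lpa_classM; split; apply/lpa_classP; [apply: Erg | apply: Egs].
- by apply: etrans; [apply/lpa_classP/ECK1 | case: ifP].
- apply: etrans; first by apply/lpa_classP/ECK2.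
  by rewrite lpa_class_sum big_map; apply: eq_bigr => e _; rewrite lpa_classM.
Qed.

Fixpoint lpa_eval (A : nalgType K) (av : vertex E -> A) (ae ag : edge E -> A)
    (t : lpa_term K E) : A :=
  let ev := lpa_eval av ae ag in
  match t with
  | Tvertex v => av v
  | Tedge e => ae e
  | Tghost e => ag e
  | Tzero => 0
  | Topp t => - ev t
  | Tadd t u => ev t + ev u
  | Tmul t u => (ev t * ev u)%g
  | Tscale k t => k *: ev t
  end.

Lemma lpa_eval_eqv (A : nalgType K) (av : vertex E -> A) (ae ag : edge E -> A) :
  leavitt_family av ae ag ->
  forall t u, lpa_eqv t u -> lpa_eval av ae ag t = lpa_eval av ae ag u.
Proof.
case=> vv se rg ck1 ck2 t u; elim=> {t u} //=; try by move=> *; congruence.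
- by move=> *; rewrite addrA.
- by move=> *; rewrite addrC.
- by move=> *; rewrite add0r.
- by move=> *; rewrite addNr.
- by move=> *; rewrite mulgA.
- by move=> *; rewrite rngDl.
- by move=> *; rewrite rngDr.
- by move=> *; rewrite scalerA.
- by move=> *; rewrite scale1r.
- by move=> *; rewrite scalerDr.
- by move=> *; rewrite scalerDl.
- by move=> *; rewrite nscaleAl.
- by move=> *; rewrite nscaleAr.
- by move=> v w; rewrite vv; case: ifP.
- by move=> e; case: (se e).
- by move=> e; case: (se e).
- by move=> e; case: (rg e).
- by move=> e; case: (rg e).
- by move=> e f; rewrite ck1; case: ifP.
- move=> v nsv fv; rewrite ck2 //.
  by elim: (enum_fset _) => [|e s IH]; rewrite ?big_nil // big_cons IH.
Qed.

Theorem lpa_universal (A : nalgType K) (av : vertex E -> A) (ae ag : edge E -> A) :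
  leavitt_family av ae ag ->
  exists! f : lpa K E -> A,
    [/\ rng_morphism f, scalable f,
        forall v, f (lpa_vertex K v) = av v,
        forall e, f (lpa_edge K e) = ae e &
        forall e, f (lpa_ghost K e) = ag e].
Proof.
move=> fam; have ev := lpa_eval_eqv fam.
exists (fun x => lpa_eval av ae ag (repr x)); split.
  have evE t : lpa_eval av ae ag (repr (lpa_class t)) = lpa_eval av ae ag t.
    exact/ev/lpa_repr.
  split=> [|k|v|e|e]; rewrite ?evE //.
    split=> x y; elim/lpa_ind: x => t; elim/lpa_ind: y => u.
      by rewrite -lpa_classD !evE.
    by rewrite -lpa_classM !evE.
  by elim/lpa_ind=> t; rewrite -lpa_classZ !evE.
move=> g [[gD gM] gZ gv ge gg].
have g0 : g 0 = 0 by apply: (@addrI _ (g 0)); rewrite -gD !addr0.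
have gN x : g (- x) = - g x.
  by apply: (@addrI _ (g x)); rewrite -gD !subrr.
suff gE t : g (lpa_class t) = lpa_eval av ae ag t.
  by apply/funext=> x; rewrite -gE /lpa_class reprK.
elim: t => /= [v|e|e||t <-|t <- u <-|t <- u <-|k t <-] //.
- exact: gv.
- exact: ge.
- exact: gg.
- by rewrite lpa_classN gN.
- by rewrite lpa_classD gD.
- by rewrite lpa_classM gM.
- by rewrite lpa_classZ gZ.
Qed.

End UniversalProperty.

(* Main.v *)
Require Import Defs.
From HB Require Import structures.
From mathcomp Require Import all_boot all_algebra.
From mathcomp Require Import ring_quotient boolp classical_sets.
From mathcomp Require Import finmap cardinality zify.

Set Implicit Arguments.
Unset Strict Implicit.
Unset Printing Implicit Defensive.
Import GRing.Theory.

Local Open Scope classical_set_scope.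
Local Open Scope ring_scope.

Local Notation "x ** y" := (x * y)%g (at level 40, left associativity).

(* The image N of I under the isomorphism is generated by idempotents, since the graded
   ideal I is generated by the vertices it contains.  An ideal N of a Z-graded ring R that
   is generated by idempotents is graded: if u in N is idempotent with components u_n,
   then q(z) = sum_n u_n z^n is an idempotent of (R/N)[z, 1/z] with q(1) = 0, so q is
   divisible by (z - 1)^k for every k, and q = 0.  Hence N is a nontrivial graded ideal.
   A graded ideal is determined by the hereditary saturated set of its vertices, and
   HS = 1 leaves only one such set different from the empty and the full one. *)

(** * Rngs without unit and their two-sided ideals *)

Section Rngs.
Variable R : rngType.
Implicit Types (x y : R) (N : R -> Prop).

Lemma rng0M x : 0 ** x = 0 :> R.
Proof. by apply: (@addrI _ (0 ** x)); rewrite -rngDl !addr0. Qed.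

Lemma rngM0 x : x ** 0 = 0 :> R.
Proof. by apply: (@addrI _ (x ** 0)); rewrite -rngDr !addr0. Qed.

Lemma rng_suml (T : Type) (s : seq T) (P : pred T) (G : T -> R) y :
  (\sum_(i <- s | P i) G i) ** y = \sum_(i <- s | P i) G i ** y.
Proof.
apply: (big_morph (fun x => x ** y)) => [x z|]; [exact: rngDl | exact: rng0M].
Qed.

Lemma rng_sumr (T : Type) (s : seq T) (P : pred T) (G : T -> R) y :
  y ** (\sum_(i <- s | P i) G i) = \sum_(i <- s | P i) y ** G i.
Proof.
apply: (big_morph (fun x => y ** x)) => [x z|]; [exact: rngDr | exact: rngM0].
Qed.

(** Ideals are [Prop]-valued predicates here, so that images, preimages, graded cores and the zero
    ideal are all covered without building a [rng_ideal]. *)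
Record ideal N : Prop := Ideal {
  ideal0 : N 0;
  idealD : forall x y, N x -> N y -> N (x + y);
  idealN : forall x, N x -> N (- x);
  idealMl : forall x y, N y -> N (x ** y);
  idealMr : forall x y, N x -> N (x ** y) }.

Lemma ideal_sum N (T : eqType) (s : seq T) (G : T -> R) :
  ideal N -> (forall i, i \in s -> N (G i)) -> N (\sum_(i <- s) G i).
Proof.
move=> iN NG; rewrite big_seq.
by apply: (big_ind N) => //; [apply: ideal0 | apply: idealD].
Qed.

Lemma rng_ideal_ideal (I : rng_ideal R) : ideal (fun x => x \in I).
Proof.
split=> [|x y|x|x y|x y]; [exact: rpred0 | exact: rpredD | by rewrite rpredN |..].
- exact: rng_idealMl.
- exact: rng_idealMr.
Qed.

End Rngs.

(** * Linear spans *)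

Section Spans.
Variable K : pzRingType.

Inductive span (V : lmodType K) (P : V -> Prop) : V -> Prop :=
  | span0 : span P 0
  | spanD x y : span P x -> span P y -> span P (x + y)
  | spanZ k x : P x -> span P (k *: x).

Section Linear.
Variables (V : lmodType K) (P : V -> Prop).

Lemma span_gen x : P x -> span P x.
Proof. by move=> Px; rewrite -[x]scale1r; apply: spanZ. Qed.

Lemma span_scale k x : span P x -> span P (k *: x).
Proof.
elim=> [|{}x y _ Sx _ Sy|l {}x Px]; first by rewrite scaler0; apply: span0.
- by rewrite scalerDr; apply: spanD.
- by rewrite scalerA; apply: spanZ.
Qed.

Lemma span_sum (T : eqType) (s : seq T) (G : T -> V) :
  (forall i, i \in s -> span P (G i)) -> span P (\sum_(i <- s) G i).
Proof.
move=> PG; rewrite big_seq.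
by apply: (big_ind (span P)) => //; [apply: span0 | apply: spanD].
Qed.

(** This connects the inductive span, convenient for induction, with the indexed sums used in
    [lpa_component]. *)
Lemma span_coef x : span P x -> exists (m : nat) (k : 'I_m -> K) (y : 'I_m -> V),
  (forall i, P (y i)) /\ x = \sum_i k i *: y i.
Proof.
elim=> [|{}x y _ [m [k [u [Pu ->]]]] _ [n [l [w [Pw ->]]]]|k {}x Px].
- exists 0%N, (fun=> 0), (fun=> 0); split; first by case.
  by rewrite big_ord0.
- exists (m + n)%N.
  exists (fun i => match split i with inl a => k a | inr b => l b end).
  exists (fun i => match split i with inl a => u a | inr b => w b end).
  split=> [i|]; first by case: (split i).
  rewrite big_split_ord /=; congr (_ + _); apply: eq_bigr => i _.
    by rewrite (unsplitK (inl i)).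
  by rewrite (unsplitK (inr i)).
- exists 1%N, (fun=> k), (fun=> x); split=> //.
  by rewrite big_ord_recl big_ord0 addr0.
Qed.

Lemma span_sub (Q : V -> Prop) x : (forall y, P y -> Q y) -> span P x -> span Q x.
Proof. by move=> PQ; elim=> *; [exact: span0 | exact: spanD | exact/spanZ/PQ]. Qed.

Lemma span_closed (Q : V -> Prop) x :
  Q 0 -> (forall y z, Q y -> Q z -> Q (y + z)) -> (forall k y, P y -> Q (k *: y)) ->
  span P x -> Q x.
Proof. by move=> Q0 QD QZ; elim=> *; [exact: Q0 | exact: QD | exact: QZ]. Qed.

End Linear.

Variables (A : nalgType K) (P Q : A -> Prop).

Lemma span_mull a x :
  (forall y, P y -> span Q (a ** y)) -> span P x -> span Q (a ** x).
Proof.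
move=> PQ; elim=> [|{}x y _ Sx _ Sy|l {}x Px]; first by rewrite rngM0; apply: span0.
- by rewrite rngDr; apply: spanD.
- by rewrite -nscaleAr; apply/span_scale/PQ.
Qed.

Lemma span_mulr a x :
  (forall y, P y -> span Q (y ** a)) -> span P x -> span Q (x ** a).
Proof.
move=> PQ; elim=> [|{}x y _ Sx _ Sy|l {}x Px]; first by rewrite rng0M; apply: span0.
- by rewrite rngDl; apply: spanD.
- by rewrite -nscaleAl; apply/span_scale/PQ.
Qed.

End Spans.

(** * Finite differences and interpolation of two-sided sequences *)

Section Sequences.
Variable V : zmodType.
Implicit Types f g h : int -> V.

(** Discrete integration: [G] sums [h] from 0 upwards, and with a minus sign downwards ([Negz n]
    being -(n+1)). A constant then adjusts the value at [c]. *)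
Lemma antidifference h (c : int) a :
  exists2 g : int -> V, g c = a & forall i, g (i + 1) - g i = h i.
Proof.
pose G i := match i with
  | Posz n => \sum_(j < n) h j%:Z
  | Negz n => - \sum_(j < n.+1) h (Negz j)
  end.
have GE i : G (i + 1) - G i = h i.
  case: i => [n|[|n]].
  - have -> : n%:Z + 1 = Posz n.+1 by lia.
    by rewrite /= big_ord_recr /= addrAC subrr add0r.
  - have -> : Negz 0 + 1 = Posz 0 by lia.
    by rewrite /= big_ord0 big_ord1 sub0r opprK.
  - have -> : Negz n.+1 + 1 = Negz n by lia.
    by rewrite /= opprK (big_ord_recr n.+1) /= addrA addNr add0r.
exists (fun i => G i - G c + a) => [|i]; first by rewrite subrr add0r.
by rewrite opprD addrACA subrr addr0 opprB addrA addrNK GE.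
Qed.

(** The [k]-th differences lie in [P]. When [P] is an ideal, these are the sequences that are
    polynomial of degree less than [k] modulo [P]. *)
Fixpoint polynomial_seq (P : V -> Prop) k g : Prop :=
  if k is k'.+1 then polynomial_seq P k' (fun i => g (i + 1) - g i)
  else forall i, P (g i).

(** Newton interpolation: the differences of [f] are interpolated at one point fewer, then summed
    with the value of [f] at [c] as initial condition. *)
Lemma polynomial_interpolation (P : V -> Prop) k c f : P 0 ->
  exists2 g, polynomial_seq P k g & forall j, (j < k)%N -> g (c + j%:Z) = f (c + j%:Z).
Proof.
move=> P0; elim: k c f => [|k IH] c f; first by exists (fun=> 0).
have [h hk hf] := IH c (fun i => f (i + 1) - f i).
have [g gc gh] := antidifference h c (f c).
exists g => /= [|j].
  by have -> : (fun i => g (i + 1) - g i) = h by apply/funext.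
elim: j => [|j IHj] jk; first by rewrite addr0.
have := hf j jk; rewrite -gh IHj ?(ltnW jk) //= => /addIr.
by rewrite -!addrA -PoszD addn1.
Qed.

End Sequences.

Section LeavittPathAlgebras.
Variables (K : fieldType) (E : graph).
Local Notation L := (lpa K E).
Local Notation vtx := (@lpa_vertex K E).
Local Notation edg := (@lpa_edge K E).
Local Notation gho := (@lpa_ghost K E).
Implicit Types (v w : vertex E) (e f : edge E) (es fs : seq (edge E)).
Implicit Types (x y : L) (N : L -> Prop).

(** * Products of generators *)

Lemma vtxM v w : vtx v ** vtx w = if v == w then vtx v else 0.
Proof. by case: (lpa_leavitt_family K E). Qed.

Lemma vtxMid v : vtx v ** vtx v = vtx v.
Proof. by rewrite vtxM eqxx. Qed.

Lemma src_edge e : vtx (esrc e) ** edg e = edg e.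
Proof. by case: (lpa_leavitt_family K E) => _ /(_ e)[]. Qed.

Lemma edge_tgt e : edg e ** vtx (etgt e) = edg e.
Proof. by case: (lpa_leavitt_family K E) => _ /(_ e)[]. Qed.

Lemma tgt_ghost e : vtx (etgt e) ** gho e = gho e.
Proof. by case: (lpa_leavitt_family K E) => _ _ /(_ e)[]. Qed.

Lemma ghost_src e : gho e ** vtx (esrc e) = gho e.
Proof. by case: (lpa_leavitt_family K E) => _ _ /(_ e)[]. Qed.

Lemma ghost_edge e f : gho e ** edg f = if e == f then vtx (etgt e) else 0.
Proof. by case: (lpa_leavitt_family K E). Qed.

Lemma vtx_edge v e : vtx v ** edg e = if v == esrc e then edg e else 0.
Proof.
rewrite -src_edge mulgA vtxM; case: eqP => [->|_]; by rewrite ?rng0M.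
Qed.

Lemma edge_vtx e v : edg e ** vtx v = if etgt e == v then edg e else 0.
Proof.
rewrite -edge_tgt -mulgA vtxM; case: eqP => _; by rewrite ?rngM0 ?edge_tgt.
Qed.

Lemma vtx_ghost v e : vtx v ** gho e = if v == etgt e then gho e else 0.
Proof.
rewrite -tgt_ghost mulgA vtxM; case: eqP => [->|_]; by rewrite ?rng0M.
Qed.

Lemma ghost_vtx e v : gho e ** vtx v = if esrc e == v then gho e else 0.
Proof.
rewrite -ghost_src -mulgA vtxM; case: eqP => _; by rewrite ?rngM0 ?ghost_src.
Qed.

Lemma vtx_sum v : row_finite E -> ~ sink v ->
  vtx v = \sum_(e <- fset_set (emitted v)) edg e ** gho e.
Proof. by move=> rf nv; case: (lpa_leavitt_family K E) => _ _ _ _; apply. Qed.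

(** * Local units *)

Definition vtx_unit (s : seq (vertex E)) : L := \sum_(v <- s) vtx v.

Lemma vtx_unitl s v : uniq s -> v \in s -> vtx_unit s ** vtx v = vtx v.
Proof.
move=> us vs; rewrite rng_suml (bigD1_seq v) //= vtxMid big1 ?addr0 // => w.
by rewrite vtxM => /negPf ->.
Qed.

Lemma vtx_unitr s v : uniq s -> v \in s -> vtx v ** vtx_unit s = vtx v.
Proof.
move=> us vs; rewrite rng_sumr (bigD1_seq v) //= vtxMid big1 ?addr0 // => w.
by rewrite vtxM eq_sym => /negPf ->.
Qed.

(** Asking for all large enough vertex lists [s], rather than for one, lets the induction use a
    common list for both terms of a sum or product. *)
Lemma local_unit_large x : exists s0 : seq (vertex E), forall s, uniq s -> {subset s0 <= s} ->
  vtx_unit s ** x = x /\ x ** vtx_unit s = x.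
Proof.
have subset_l (r r' : seq (vertex E)) : {subset r <= r ++ r'}.
  by move=> v vr; rewrite mem_cat vr.
have subset_r (r r' : seq (vertex E)) : {subset r' <= r ++ r'}.
  by move=> v vr; rewrite mem_cat vr orbT.
elim/lpa_ind: x; elim=> [v|e|e||t [s0 IH]|t [s0 IHt] u [s1 IHu]
    |t [s0 IHt] u [s1 IHu]|k t [s0 IH]].
- exists [:: v] => s us sub; have vs : v \in s by rewrite sub ?inE.
  by rewrite vtx_unitl ?vtx_unitr.
- exists [:: esrc e; etgt e] => s us sub.
  have [es ts] : esrc e \in s /\ etgt e \in s by rewrite !sub ?inE ?eqxx ?orbT.
  change (lpa_class (Tedge K e)) with (edg e); split.
    by rewrite -src_edge mulgA vtx_unitl.
  by rewrite -edge_tgt -mulgA vtx_unitr.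
- exists [:: esrc e; etgt e] => s us sub.
  have [es ts] : esrc e \in s /\ etgt e \in s by rewrite !sub ?inE ?eqxx ?orbT.
  change (lpa_class (Tghost K e)) with (gho e); split.
    by rewrite -tgt_ghost mulgA vtx_unitl.
  by rewrite -ghost_src -mulgA vtx_unitr.
- exists [::] => s _ _; change (lpa_class (Tzero K E)) with (0 : L).
  by rewrite rng0M rngM0.
- exists s0 => s us sub; have [l r] := IH s us sub.
  by rewrite lpa_classN (rngN _ _).1 (rngN _ _).2 l r.
- exists (s0 ++ s1) => s us sub.
  have [lt rt] := IHt s us (fun v vs => sub v (subset_l _ _ v vs)).
  have [lu ru] := IHu s us (fun v vs => sub v (subset_r _ _ v vs)).
  by rewrite lpa_classD rngDl rngDr lt rt lu ru.
- exists (s0 ++ s1) => s us sub.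
  have [lt _] := IHt s us (fun v vs => sub v (subset_l _ _ v vs)).
  have [_ ru] := IHu s us (fun v vs => sub v (subset_r _ _ v vs)).
  by rewrite lpa_classM mulgA lt -mulgA ru.
- exists s0 => s us sub; have [l r] := IH s us sub.
  by rewrite lpa_classZ -nscaleAr -nscaleAl l r.
Qed.

Lemma local_unit x : exists s, vtx_unit s ** x = x /\ x ** vtx_unit s = x.
Proof.
have [s0 H] := local_unit_large x; exists (undup s0).
by apply: H => [|v]; rewrite ?undup_uniq ?mem_undup.
Qed.

(** A local unit [u] absorbs the scalar: [k *: x] is the product of [k *: u] and [x]. *)
Lemma ideal_scale N k x : ideal N -> N x -> N (k *: x).
Proof.
move=> iN Nx; have [s [sx _]] := local_unit x.
by rewrite -sx nscaleAl; apply: idealMl.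
Qed.

Lemma ideal_vtx_full N x : ideal N -> (forall v, N (vtx v)) -> N x.
Proof.
move=> iN Nv; have [s [<- _]] := local_unit x.
by apply: idealMr => //; apply: ideal_sum.
Qed.

(** * The hereditary saturated set of an ideal *)

Definition vertices N : set (vertex E) := [set v | N (vtx v)].

(** Along an edge [e] from [v], the target equals [gho e ** vtx v ** edg e], whence heredity.
    Conversely [vtx v] is the sum of the elements [edg e ** vtx (etgt e) ** gho e], whence
    saturation. *)
Lemma vertices_hersat N : row_finite E -> ideal N ->
  hereditary (vertices N) /\ saturated (vertices N).
Proof.
move=> rf iN; split.
  move=> v w Nv [es + <-] {w}; elim: es v Nv => [|e es IH] v //= Nv.
  case/andP=> /eqP ev pes; apply: (IH (etgt e)) => //.
  have := ghost_edge e e; rewrite eqxx /vertices /= => <-.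
  rewrite -src_edge ev; apply: (idealMl iN); exact: (idealMr iN).
move=> v [e0 ve0] fv sub; rewrite /vertices /= vtx_sum //; last first.
  by move=> sv; move: ve0; rewrite sv.
apply: ideal_sum => // e; rewrite in_fset_set // in_setE => ve.
apply: (idealMr iN); rewrite -edge_tgt; apply: (idealMl iN).
by apply: (sub); exists e.
Qed.

(* No composability is required of [es]: a noncomposable sequence yields 0. *)
Definition real_path es w : L := foldr (fun e x => edg e ** x) (vtx w) es.
Definition ghost_path fs w : L := foldr (fun f x => x ** gho f) (vtx w) fs.
Definition monomial es w fs : L := real_path es w ** ghost_path fs w.

(** * Monomials: products with generators and comparison with paths *)

Lemma real_path_vtx es w : real_path es w ** vtx w = real_path es w.
Proof. by elim: es => [|e es IH] /=; rewrite ?vtxMid // -mulgA IH. Qed.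

Lemma vtx_ghost_path fs w : vtx w ** ghost_path fs w = ghost_path fs w.
Proof. by elim: fs => [|e fs IH] /=; rewrite ?vtxMid // mulgA IH. Qed.

(** This and the following alternatives forget which vertices must match: a generator times a
    monomial is again a monomial or 0, and a span contains both. *)
Lemma vtx_real_path v es w : vtx v ** real_path es w = real_path es w \/
  vtx v ** real_path es w = 0.
Proof.
case: es => [|e es] /=; first by rewrite vtxM; case: eqP => [->|_]; auto.
by rewrite mulgA vtx_edge; case: eqP; rewrite ?rng0M; auto.
Qed.

Lemma ghost_path_vtx v fs w : ghost_path fs w ** vtx v = ghost_path fs w \/
  ghost_path fs w ** vtx v = 0.
Proof.
case: fs => [|e fs] /=; first by rewrite vtxM; case: eqP => [->|_]; auto.
by rewrite -mulgA ghost_vtx; case: eqP; rewrite ?rngM0; auto.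
Qed.

Lemma real_path_edge es w e : real_path es w ** edg e = real_path (rcons es e) (etgt e) \/
  real_path es w ** edg e = 0.
Proof.
rewrite -real_path_vtx -mulgA vtx_edge; case: eqP => [->|_]; last by right; rewrite rngM0.
left; elim: es => [|f es IH] /=; last by rewrite -mulgA IH.
by rewrite src_edge edge_tgt.
Qed.

Lemma ghost_ghost_path e fs w : gho e ** ghost_path fs w = ghost_path (rcons fs e) (etgt e) \/
  gho e ** ghost_path fs w = 0.
Proof.
rewrite -vtx_ghost_path mulgA ghost_vtx; case: eqP => [<-|_]; last by right; rewrite rng0M.
left; elim: fs => [|f fs IH] /=; last by rewrite mulgA IH.
by rewrite ghost_src tgt_ghost.
Qed.

Lemma vtx_monomial v es w fs : vtx v ** monomial es w fs = monomial es w fs \/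
  vtx v ** monomial es w fs = 0.
Proof.
by rewrite /monomial mulgA; case: (vtx_real_path v es w) => ->; rewrite ?rng0M; auto.
Qed.

Lemma monomial_vtx v es w fs : monomial es w fs ** vtx v = monomial es w fs \/
  monomial es w fs ** vtx v = 0.
Proof.
by rewrite /monomial -mulgA; case: (ghost_path_vtx v fs w) => ->; rewrite ?rngM0; auto.
Qed.

Lemma edge_monomial e es w fs : edg e ** monomial es w fs = monomial (e :: es) w fs.
Proof. by rewrite /monomial mulgA. Qed.

Lemma ghost_monomial_cons e f es w fs :
  gho e ** monomial (f :: es) w fs = monomial es w fs \/
  gho e ** monomial (f :: es) w fs = 0.
Proof.
rewrite -edge_monomial mulgA ghost_edge; case: ifP => _; last by rewrite rng0M; auto.
exact: vtx_monomial.
Qed.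

Lemma monomial_cons_edge e es w f fs :
  monomial es w (f :: fs) ** edg e = monomial es w fs \/
  monomial es w (f :: fs) ** edg e = 0.
Proof.
rewrite /monomial /= mulgA -[_ ** gho f ** _]mulgA ghost_edge.
case: ifP => _; last by rewrite rngM0; auto.
exact: monomial_vtx.
Qed.

Lemma ghost_monomial_nil e w fs :
  gho e ** monomial [::] w fs = monomial [::] (etgt e) (rcons fs e) \/
  gho e ** monomial [::] w fs = 0.
Proof.
rewrite /monomial /= !vtx_ghost_path.
exact: ghost_ghost_path.
Qed.

Lemma monomial_nil_edge es w e :
  monomial es w [::] ** edg e = monomial (rcons es e) (etgt e) [::] \/
  monomial es w [::] ** edg e = 0.
Proof.
rewrite /monomial /= !real_path_vtx.
exact: real_path_edge.
Qed.

(** [lpa_path] folds from the left and [real_path] from the right; this recursion links them. For an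
    empty tail the extra factor [vtx (etgt e)] is absorbed by [edg e]. *)
Lemma lpa_path_cons v e es : lpa_path K v (e :: es) = edg e ** lpa_path K (etgt e) es.
Proof.
case: es => [|f es] /=; first by rewrite edge_tgt.
by elim: es (edg f) => [|g es IH] x //=; rewrite -IH mulgA.
Qed.

Lemma lpa_ghost_path_cons v e es :
  lpa_ghost_path K v (e :: es) = lpa_ghost_path K (etgt e) es ** gho e.
Proof.
case: es => [|f es] /=; first by rewrite tgt_ghost.
by elim: es (gho f) => [|g es IH] x //=; rewrite -IH mulgA.
Qed.

Lemma lpa_pathE v es : is_path v es -> lpa_path K v es = real_path es (path_end v es).
Proof.
elim: es v => [|e es IH] v //; rewrite lpa_path_cons => /andP[_ /IH ->].
by [].
Qed.

Lemma lpa_ghost_pathE v es :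
  is_path v es -> lpa_ghost_path K v es = ghost_path es (path_end v es).
Proof.
elim: es v => [|e es IH] v //; rewrite lpa_ghost_path_cons => /andP[_ /IH ->].
by [].
Qed.

(** Edges that do not compose produce a product of two distinct vertices, which is 0. The last
    clause, about the starting vertex [v], carries the induction. *)
Lemma real_path_neq0 es w : real_path es w <> 0 ->
  exists v, [/\ is_path v es, path_end v es = w & vtx v ** real_path es w = real_path es w].
Proof.
elim: es => [|e es IH] /= nz; first by exists w; rewrite vtxMid.
have [|v [pv wv vE]] := IH; first by move=> z; apply: nz; rewrite z rngM0.
exists (esrc e); rewrite mulgA src_edge /path_end /= eqxx; have <- : v = etgt e.
  by apply/eqP; apply: contra_notT nz => /negPf ne; rewrite -vE mulgA edge_vtx eq_sym ne rng0M.
by split.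
Qed.

Lemma ghost_path_neq0 es w : ghost_path es w <> 0 ->
  exists v, [/\ is_path v es, path_end v es = w & ghost_path es w ** vtx v = ghost_path es w].
Proof.
elim: es => [|e es IH] /= nz; first by exists w; rewrite vtxMid.
have [|v [pv wv vE]] := IH; first by move=> z; apply: nz; rewrite z rng0M.
exists (esrc e); rewrite -mulgA ghost_src /path_end /= eqxx; have <- : v = etgt e.
  by apply/eqP; apply: contra_notT nz => /negPf ne; rewrite -vE -mulgA vtx_ghost ne rngM0.
by split.
Qed.

(** * Homogeneous components and graded ideals *)

Definition component n : L -> Prop := span (fun x =>
  exists es w fs, (size es)%:Z - (size fs)%:Z = n /\ x = monomial es w fs).

(** From left to right, paths with different ends have product 0, as their end vertices are
    orthogonal. From right to left, a monomial is 0 or both its factors come from genuine paths. *)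
Lemma lpa_componentE n x : lpa_component n x <-> component n x.
Proof.
split.
  case=> m [k [y [my ->]]]; apply: span_sum => i _; apply: span_scale.
  have [v [es [w [fs [pv pw n_ ->]]]]] := my i.
  rewrite lpa_pathE // lpa_ghost_pathE //.
  have [<-|/negPf ne] := eqVneq (path_end v es) (path_end w fs).
    by apply: span_gen; exists es, (path_end v es), fs.
  rewrite -real_path_vtx -vtx_ghost_path -!mulgA [vtx _ ** (vtx _ ** _)]mulgA.
  by rewrite vtxM ne rng0M rngM0; apply: span0.
move=> cx; suff /span_coef[m [k [y [my ->]]]] : span (is_monomial n) x.
  by exists m, k, y.
elim: cx => [|{}x y _ Sx _ Sy|k {}x [es [w [fs [n_ ->]]]]].
- exact: span0.
- exact: spanD.
- apply: span_scale; rewrite /monomial.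
  have [->|/eqP/real_path_neq0[v [pv ev _]]] := eqVneq (real_path es w) 0.
    by rewrite rng0M; apply: span0.
  have [->|/eqP/ghost_path_neq0[u [pu eu _]]] := eqVneq (ghost_path fs w) 0.
    by rewrite rngM0; apply: span0.
  apply: span_gen; exists v, es, u, fs.
  by rewrite lpa_pathE // lpa_ghost_pathE // ev eu.
Qed.

(** For an ideal [N] this is the largest graded ideal contained in [N]. *)
Definition graded_core N : L -> Prop := span (fun y => N y /\ exists n, component n y).

Definition graded N : Prop := forall x, N x -> graded_core N x.

(** * Containment of a graded ideal, tested on vertices *)

Section Containment.
Variables (N M : L -> Prop).
Hypotheses (rfE : row_finite E) (idN : ideal N) (idM : ideal M).
Hypothesis (subNM : forall v, N (vtx v) -> M (vtx v)).

Lemma sink_edge v e : sink v -> v == esrc e = false.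
Proof.
by move=> sv; apply/eqP => ve; have : emitted v e by []; rewrite sv.
Qed.

(** A local unit reduces the claim to [vtx v ** x]. In length 0 this is [c *: vtx v], and a nonzero
    [c] puts [vtx v] into [N], hence into [M]. In positive length a sink [v] gives 0; otherwise
    [vtx v] is the sum of the [edg e ** gho e], and [gho e ** x] is an element of [N] of length one
    less. *)
Lemma real_span_contained k x :
  span (fun y => exists es w, size es = k /\ y = monomial es w [::]) x -> N x -> M x.
Proof.
elim: k x => [|k IH] x Sx Nx; have [s [<- _]] := local_unit x;
    rewrite rng_suml; apply: ideal_sum => // v _.
  have [c vx] : exists c, vtx v ** x = c *: vtx v.
    elim: Sx => [|y z _ [c yc] _ [d zd]|c y [es [w [/size0nil -> ->]]]].
    - by exists 0; rewrite scale0r rngM0.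
    - by exists (c + d); rewrite scalerDl rngDr yc zd.
    - rewrite -nscaleAr /monomial /= vtxMid vtxM.
      by case: eqP => _; [exists c | exists 0; rewrite scaler0 scale0r].
  have [c0|c0] := eqVneq c 0; first by rewrite vx c0 scale0r; apply: ideal0.
  apply: (idealMr idM); apply: subNM.
  rewrite -[vtx v]scale1r -(mulVf c0) -scalerA -vx.
  exact: (ideal_scale _ idN (idealMl idN _ Nx)).
have [sv|nsv] := pselect (sink v).
  suff -> : vtx v ** x = 0 by apply: ideal0.
  elim: Sx => [|y z _ yc _ zd|c y [[|e es] [w [//] _ ->]]].
  - by rewrite rngM0.
  - by rewrite rngDr yc zd addr0.
  - by rewrite -nscaleAr -edge_monomial mulgA vtx_edge sink_edge // rng0M scaler0.
rewrite vtx_sum // rng_suml; apply: ideal_sum => // e _.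
rewrite -mulgA; apply: (idealMl idM); apply: IH; last exact: (idealMl idN).
apply: span_mull Sx => y [[|f es] [w [//] [ks] ->]].
case: (ghost_monomial_cons e f es w [::]) => ->; last exact: span0.
by apply: span_gen; exists es, w.
Qed.

Definition bounded_monomial n m x : Prop := exists es w fs,
  [/\ (size es)%:Z - (size fs)%:Z = n, (size fs <= m)%N & x = monomial es w fs].

(** Induction on the length of the ghost parts. If [v] is not a sink, [x ** vtx v] is the sum of the
    [x ** edg e ** gho e], where [x ** edg e] has shorter ghost parts and degree one higher. If [v]
    is a sink, only monomials without ghost edges survive multiplication by [vtx v]. *)
Lemma bounded_span_contained n m x : span (bounded_monomial n m) x -> N x -> M x.
Proof.
have base k y : span (bounded_monomial k 0) y -> N y -> M y.
  (* Without ghost edges the degree is the length, so for negative [k] there are no such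
     monomials. *)
  move=> Sy; apply: (@real_span_contained `|k|%N); apply: span_sub Sy => z [es [w [fs]]].
  case=> k_ /[!leqn0] /nilP fs0 ->; rewrite {}fs0 /= in k_ *.
  by exists es, w; split=> //; lia.
elim: m n x => [|m IH] n x Sx Nx; first exact: (base n).
have [s [_ <-]] := local_unit x.
rewrite rng_sumr; apply: ideal_sum => // v _.
have [sv|nsv] := pselect (sink v).
  apply: (base n); last exact: (idealMr idN).
  apply: span_mulr Sx => _ [es [w [[|f fs] [n_ _ ->]]]].
    case: (monomial_vtx v es w [::]) => ->; last exact: span0.
    by apply: span_gen; exists es, w, [::].
  rewrite /monomial -!mulgA ghost_vtx eq_sym sink_edge // !rngM0; exact: span0.
rewrite vtx_sum // rng_sumr; apply: ideal_sum => // e _.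
rewrite mulgA; apply: (idealMr idM); apply: (IH (n + 1)); last exact: (idealMr idN).
apply: span_mulr Sx => _ [es [w [[|f fs] [n_ fm ->]]]].
  case: (monomial_nil_edge es w e) => ->; last exact: span0.
  apply: span_gen; exists (rcons es e), (etgt e), [::].
  by split=> //=; rewrite size_rcons; move: n_ => /=; lia.
case: (monomial_cons_edge e es w f fs) => ->; last exact: span0.
by apply: span_gen; exists es, w, fs; split=> //=; move: n_ => /=; lia.
Qed.

Lemma component_bounded n x : component n x -> exists m, span (bounded_monomial n m) x.
Proof.
have mono m m' y : (m <= m')%N -> bounded_monomial n m y -> bounded_monomial n m' y.
  by move=> mm' [es [w [fs [n_ fm ->]]]]; exists es, w, fs; split=> //; apply: leq_trans mm'.
elim=> [|{}x y _ [m Sx] _ [m' Sy]|k {}x [es [w [fs [n_ ->]]]]].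
- by exists 0%N; apply: span0.
- exists (maxn m m'); apply: spanD.
    by apply: span_sub Sx => z; apply: mono; apply: leq_maxl.
  by apply: span_sub Sy => z; apply: mono; apply: leq_maxr.
- by exists (size fs); apply: spanZ; exists es, w, fs.
Qed.

(** In this sense a graded ideal is generated by its vertices. The ideal [M] is arbitrary; it will
    also be the zero ideal and the preimage of a graded core. *)
Lemma graded_contained x : graded N -> N x -> M x.
Proof.
move=> gN /gN; apply: span_closed; first exact: ideal0.
  exact: idealD.
move=> k y [Ny [n /component_bounded[m Sy]]].
by apply: ideal_scale => //; apply: bounded_span_contained Sy Ny.
Qed.

End Containment.

(** * Homogeneous elements as multiplication operators *)

(** In this form products are immediate and only the generators need checking, which avoids
    cancelling ghost edges against edges inside a product of two monomials. *)
Definition multiplier n x : Prop :=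
  forall m y, component m y -> component (n + m) (x ** y).

Lemma multiplierD n x y : multiplier n x -> multiplier n y -> multiplier n (x + y).
Proof. by move=> hx hy m z cz; rewrite rngDl; apply: spanD; [apply: hx | apply: hy]. Qed.

Lemma multiplierZ n k x : multiplier n x -> multiplier n (k *: x).
Proof. by move=> hx m z cz; rewrite -nscaleAl; apply/span_scale/hx. Qed.

Lemma multiplierM n m x y : multiplier n x -> multiplier m y -> multiplier (n + m) (x ** y).
Proof. by move=> hx hy p z cz; rewrite -mulgA -addrA; apply/hx/hy. Qed.

Lemma multiplier_vtx v : multiplier 0 (vtx v).
Proof.
move=> m y; apply: span_mull => _ [es [w [fs [m_ ->]]]].
case: (vtx_monomial v es w fs) => ->; last exact: span0.
by apply: span_gen; exists es, w, fs; rewrite add0r.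
Qed.

Lemma multiplier_edge e : multiplier 1 (edg e).
Proof.
move=> m y; apply: span_mull => _ [es [w [fs [m_ ->]]]]; rewrite edge_monomial.
by apply: span_gen; exists (e :: es), w, fs; split=> //=; lia.
Qed.

Lemma multiplier_ghost e : multiplier (-1) (gho e).
Proof.
move=> m y; apply: span_mull => _ [[|f es] [w [fs [m_ ->]]]].
  case: (ghost_monomial_nil e w fs) => ->; last exact: span0.
  apply: span_gen; exists [::], (etgt e), (rcons fs e).
  by split=> //; rewrite size_rcons; move: m_ => /=; lia.
case: (ghost_monomial_cons e f es w fs) => ->; last exact: span0.
by apply: span_gen; exists es, w, fs; split=> //; move: m_ => /=; lia.
Qed.

Lemma component_vtx_unit s : component 0 (vtx_unit s).
Proof.
apply: span_sum => v _; apply: span_gen; exists [::], v, [::].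
by rewrite /monomial /= vtxMid.
Qed.

(** A multiplier is recovered from its value on a local unit, which has degree 0. *)
Lemma multiplierP n x : multiplier n x <-> component n x.
Proof.
split=> [hx|].
  have [s [_ <-]] := local_unit x; rewrite -[n]addr0.
  exact/hx/component_vtx_unit.
elim=> [|{}x y _ hx _ hy|k {}x [es [w [fs [<- ->]]]]].
- by move=> m y _; rewrite rng0M; apply: span0.
- exact: multiplierD.
- apply/multiplierZ/multiplierM.
    elim: es => [|e es IH] /=; first exact: multiplier_vtx.
    by rewrite -add1n PoszD; apply/multiplierM/IH/multiplier_edge.
  elim: fs => [|f fs IH] /=; first exact: multiplier_vtx.
  by rewrite -addn1 PoszD opprD; apply/multiplierM/multiplier_ghost.
Qed.

(* The homomorphism from L to L[z, 1/z] sending [x] of degree n to [x z^n], with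
   L[z, 1/z] acting on two-sided sequences through the shift [z]. *)
Fixpoint act (t : lpa_term K E) (f : int -> L) (i : int) : L :=
  match t with
  | Tvertex v => vtx v ** f i
  | Tedge e => edg e ** f (i - 1)
  | Tghost e => gho e ** f (i + 1)
  | Tzero => 0
  | Topp t => - act t f i
  | Tadd t u => act t f i + act u f i
  | Tmul t u => act t (act u f) i
  | Tscale k t => k *: act t f i
  end.

(** A single list [s] gives both the homogeneous pieces of [t] and its action. Components can thus
    be read off from [act t], without first showing that the sum of the components is direct. *)
Lemma act_decomposition t : exists s : seq (int * L),
  [/\ forall p, p \in s -> component p.1 p.2,
      lpa_class t = \sum_(p <- s) p.2 &
      forall (f : int -> L) i, act t f i = \sum_(p <- s) p.2 ** f (i - p.1)].
Proof.
elim: t => [v|e|e||t [s [hs xs as_]]|t [s [hs xs as_]] u [r [hr xr ar]]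
    |t [s [hs xs as_]] u [r [hr xr ar]]|k t [s [hs xs as_]]].
- exists [:: (0, vtx v)]; split=> [p|| f i]; rewrite ?big_seq1 ?subr0 //.
  by rewrite inE => /eqP ->; apply/multiplierP/multiplier_vtx.
- exists [:: (1, edg e)]; split=> [p|| f i]; rewrite ?big_seq1 //.
  by rewrite inE => /eqP ->; apply/multiplierP/multiplier_edge.
- exists [:: (-1, gho e)]; split=> [p|| f i]; rewrite ?big_seq1 /= ?opprK //.
  by rewrite inE => /eqP ->; apply/multiplierP/multiplier_ghost.
- by exists [::]; split=> [p|| f i]; rewrite ?big_nil.
- exists [seq (p.1, - p.2) | p <- s]; split=> [_ /mapP[p ps ->]|| f i] /=.
  + by rewrite -scaleN1r; apply/span_scale/hs.
  + by rewrite big_map lpa_classN xs -sumrN.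
  + by rewrite big_map as_ -sumrN; apply: eq_bigr => p _; rewrite (rngN _ _).1.
- exists (s ++ r); split=> [p|| f i] /=.
  + by rewrite mem_cat => /orP[/hs|/hr].
  + by rewrite big_cat lpa_classD xs xr.
  + by rewrite big_cat as_ ar.
- exists [seq (p.1 + q.1, p.2 ** q.2) | p <- s, q <- r].
  split=> [_ /allpairsP[[p q] [/= ps qr ->]]|| f i] /=.
  + by apply/multiplierP/multiplierM; apply/multiplierP; [apply: hs | apply: hr].
  + rewrite big_allpairs_dep /= lpa_classM xs xr rng_suml.
    by apply: eq_bigr => p _; rewrite rng_sumr.
  + rewrite big_allpairs_dep /= as_; apply: eq_bigr => p _; rewrite ar rng_sumr.
    by apply: eq_bigr => q _; rewrite /= mulgA opprD addrA.
- exists [seq (p.1, k *: p.2) | p <- s]; split=> [_ /mapP[p ps ->]|| f i] /=.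
  + exact/span_scale/hs.
  + by rewrite big_map lpa_classZ xs -scaler_sumr.
  + by rewrite big_map as_ scaler_sumr; apply: eq_bigr => p _; rewrite nscaleAl.
Qed.

Lemma actD t (f g : int -> L) i : act t (fun j => f j + g j) i = act t f i + act t g i.
Proof.
have [s [_ _ as_]] := act_decomposition t.
by rewrite !as_ -big_split; apply: eq_bigr => p _; rewrite rngDr.
Qed.

Lemma actZ t k (f : int -> L) i : act t (fun j => k *: f j) i = k *: act t f i.
Proof.
have [s [_ _ as_]] := act_decomposition t.
by rewrite !as_ scaler_sumr; apply: eq_bigr => p _; rewrite nscaleAr.
Qed.

(** The defining relations are homogeneous, so the shifts on their two sides agree. *)
Lemma act_eqv t u : lpa_eqv t u -> act t = act u.
Proof.
move=> tu; apply/funext => f; apply/funext => i.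
elim: tu f i => {t u} //=.
- by move=> t u w _ IH1 _ IH2 f i; rewrite IH1.
- by move=> t t' _ IH f i; rewrite IH.
- by move=> t t' u u' _ IH1 _ IH2 f i; rewrite IH1 IH2.
- by move=> t t' u u' _ IH1 _ IH2 f i; rewrite IH1; congr act; apply/funext.
- by move=> k t t' _ IH f i; rewrite IH.
- by move=> *; rewrite addrA.
- by move=> *; rewrite addrC.
- by move=> *; rewrite add0r.
- by move=> *; rewrite addNr.
- by move=> t u w f i; rewrite actD.
- by move=> *; rewrite scalerA.
- by move=> *; rewrite scale1r.
- by move=> *; rewrite scalerDr.
- by move=> *; rewrite scalerDl.
- by move=> k t u f i; rewrite actZ.
- by move=> v w f i; rewrite mulgA vtxM; case: eqP => // _; rewrite rng0M.
- by move=> e f i; rewrite mulgA src_edge.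
- by move=> e f i; rewrite mulgA edge_tgt.
- by move=> e f i; rewrite mulgA tgt_ghost.
- by move=> e f i; rewrite mulgA ghost_src.
- by move=> e f g i; rewrite addrK mulgA ghost_edge; case: eqP => // _; rewrite rng0M.
- move=> v nsv fv f i; have [_ _ _ _ /(_ v nsv fv) ->] := lpa_leavitt_family K E.
  rewrite rng_suml; elim: (enum_fset _) => [|e s IH]; rewrite ?big_nil // big_cons.
  by rewrite IH /= subrK mulgA.
Qed.

(** * Homogeneous components of an idempotent in an ideal *)

Section IdempotentComponents.
Variables (N : L -> Prop) (t : lpa_term K E).
Hypotheses (idN : ideal N) (Nt : N (lpa_class t)).
Hypothesis tt : lpa_class t ** lpa_class t = lpa_class t.

Lemma act_idempotent (f : int -> L) : act t (act t f) = act t f.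
Proof.
have /act_eqv tE : lpa_eqv (Tmul t t) t by apply/lpa_classP; rewrite lpa_classM.
by rewrite -[RHS](congr1 (fun F => F f) tE).
Qed.

(* Modulo N, the commutation of [act t] with differences makes [act t g] constant by
   induction, and [act t] kills constants because [lpa_class t] is in N. *)
Lemma act_polynomial k (g : int -> L) i : polynomial_seq N k g -> N (act t g i).
Proof.
have [s [_ ts tE]] := act_decomposition t.
elim: k g i => [|k IH] g i /=.
  by move=> Ng; rewrite tE; apply: ideal_sum => // p _; apply: (idealMl idN).
move=> /IH {IH} Ndg; set h := act t g.
have step j : N (h (j + 1) - h j).
  have := Ndg j; rewrite /h !tE -sumrB; congr N; apply: eq_bigr => p _.
  by rewrite rngDr (rngN _ _).2 addrAC.
have const j : N (h j - h 0).
  have up (n : nat) a : N (h (a + n%:Z) - h a).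
    elim: n => [|n IHn]; first by rewrite addr0 subrr; apply: ideal0.
    rewrite -addn1 PoszD addrA -[_ - _](subrKA (h (a + n%:Z))).
    exact: (idealD idN).
  case: (intP j) => [|n|n]; first by rewrite subrr; apply: ideal0.
    by have := up n.+1 0; rewrite add0r.
  by have := up n.+1 (- n.+1%:Z); rewrite addNr -opprB => /(idealN idN); rewrite opprK.
(* By idempotence [h] equals [act t h], so that [h] being constant modulo [N] can be used inside
   [act t]. *)
rewrite /h -(act_idempotent g) tE -/h.
have -> : \sum_(p <- s) p.2 ** h (i - p.1) =
    \sum_(p <- s) p.2 ** (h (i - p.1) - h 0) + lpa_class t ** h 0.
  rewrite ts rng_suml -big_split; apply: eq_bigr => p _ /=.
  by rewrite -rngDr subrK.
apply: (idealD idN); last exact: (idealMr idN).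
by apply: ideal_sum => // p _; apply: (idealMl idN).
Qed.

(** The value at [i] involves only finitely many values of [f], so [f] can be replaced by an
    interpolating polynomial sequence. *)
Lemma act_contained (f : int -> L) i : N (act t f i).
Proof.
have [s [_ ts tE]] := act_decomposition t.
have [m sm] : exists m : nat, forall p, p \in s -> (`|p.1| <= m)%N.
  elim: (s) => [|p r [m rm]]; first by exists 0%N.
  exists (maxn `|p.1| m) => q; rewrite inE => /orP[/eqP ->|/rm qm]; first exact: leq_maxl.
  exact: leq_trans (leq_maxr _ _).
(* The degrees in [s] have absolute value at most [m], so [f] is read only on the 2m+1 points from
   i-m to i+m. *)
have [g gk gf] := polynomial_interpolation (m + m).+1 (i - m%:Z) f (ideal0 idN).
have -> : act t f i = act t g i.
  rewrite !tE; apply: eq_big_seq => p /sm pm.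
  have -> : i - p.1 = i - m%:Z + `|m%:Z - p.1|%N%:Z by lia.
  by rewrite gf //; lia.
exact: act_polynomial gk.
Qed.

Lemma idempotent_graded : graded_core N (lpa_class t).
Proof.
have [s [hs -> tE]] := act_decomposition t.
(* Degrees may repeat in [s], and it is the sum of all entries of one degree that is shown to lie in
   [N]. *)
set ds := undup [seq p.1 | p <- s].
have -> : \sum_(p <- s) p.2 = \sum_(d <- ds) \sum_(p <- s | p.1 == d) p.2.
  under [RHS]eq_bigr do rewrite big_mkcond.
  rewrite exchange_big; apply: eq_big_seq => p ps.
  rewrite (bigD1_seq p.1) ?undup_uniq ?mem_undup ?map_f //= eqxx big1 ?addr0 // => d.
  by rewrite eq_sym => /negPf ->.
apply: span_sum => d _; apply: span_gen; set y := \sum_(p <- s | _) _; split; last first.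
  exists d; rewrite /y big_seq_cond.
  apply: (big_ind (component d)) => [||p /andP[ps /eqP <-]]; [exact: span0 | exact: spanD |].
  exact: hs.
have [r [_ <-]] := local_unit y.
(* On the sequence with a local unit of [y] at 0 and zeros elsewhere, [act t] takes at [d] the value
   [y ** vtx_unit r], that is [y]. *)
have := act_contained (fun i => if i == 0 then vtx_unit r else 0) d.
rewrite tE; congr N; rewrite /y rng_suml [RHS]big_mkcond; apply: eq_bigr => p _.
by rewrite subr_eq0 eq_sym; case: eqP; rewrite ?rngM0.
Qed.

End IdempotentComponents.

(** * The graded core is an ideal *)

Lemma span_components x : span (fun y => exists n, component n y) x.
Proof.
elim/lpa_ind: x => t; have [s [hs -> _]] := act_decomposition t.
by apply: span_sum => p ps; apply: span_gen; exists p.1; apply: hs.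
Qed.

Lemma componentM n m x y : component n x -> component m y -> component (n + m) (x ** y).
Proof. by move/multiplierP; apply. Qed.

Lemma graded_core_ideal N : ideal N -> ideal (graded_core N).
Proof.
move=> iN; split; [exact: span0 | exact: spanD | | |].
- by move=> x Nx; rewrite -scaleN1r; apply: span_scale.
- move=> x y; apply: span_mull => {}y [Ny [m cy]].
  apply: span_mulr (span_components x) => {}x [n cx]; apply: span_gen.
  by split; [apply: (idealMl iN) | exists (n + m); apply: componentM].
- move=> x y; apply: span_mulr => {}x [Nx [n cx]].
  apply: span_mull (span_components y) => {}y [m cy]; apply: span_gen.
  by split; [apply: (idealMr iN) | exists (n + m); apply: componentM].
Qed.

Lemma idempotent_graded_core N x : ideal N -> N x -> x ** x = x -> graded_core N x.
Proof. by move=> iN; elim/lpa_ind: x => t Nt tt; apply: idempotent_graded. Qed.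

Lemma graded_ideal_graded (I : rng_ideal L) : graded_ideal I -> graded (fun x => x \in I).
Proof.
move=> gI x Ix; have [m [d [y [Hy ->]]]] := gI x Ix.
apply: span_sum => i _; apply: span_gen; have [cy Iy] := Hy i.
by split=> //; exists (d i); apply/lpa_componentE.
Qed.

(** * Counting hereditary saturated sets *)

(** There are exactly three hereditary saturated sets, whereas [set0], [setT] and distinct [A] and
    [B] would make four. *)
Lemma HS1_unique (A B : set (vertex E)) : HS E = 1 ->
  @HerSat E A -> @HerSat E B -> A <> set0 -> A <> setT -> B <> set0 -> B <> setT -> A = B.
Proof.
rewrite /HS => HS1 hA hB A0 AT B0 BT.
have card3 : #|` fset_set (@HerSat E)| = 3%N by lia.
have fin : finite_set (@HerSat E).
  (* For an infinite [HerSat] the default value of [fset_set] is empty, so its cardinal would be 0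
     and not 3. *)
  apply: contrapT => inf; move: card3; rewrite /fset_set.
  by case: pselect => // _; rewrite cardfs0.
have h0 : @HerSat E set0.
  by split=> // v [e ve] _ sub; apply: (sub (etgt e)); exists e.
have hT : @HerSat E setT by [].
apply: contrapT => AB; suff : (4 <= 3)%N by [].
rewrite -[X in (_ <= X)%N]card3.
have us : uniq [:: set0; setT; A; B].
  have ne (C D : set (vertex E)) : C <> D -> (D == C) = false by move=> CD; apply/eqP => /esym.
  have T0 : setT <> set0 :> set (vertex E) by move=> T0; apply: A0; rewrite -subset0 -T0.
  by rewrite /= !inE (ne _ _ T0) !(ne _ _ A0, ne _ _ AT, ne _ _ B0, ne _ _ BT) (ne _ _ (nesym AB)).
rewrite -[4%N]/(size [:: set0; setT; A; B]); apply: uniq_leq_size us _ => C.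
by rewrite !inE => /or4P[] /eqP ->; rewrite in_fset_set // in_setE.
Qed.

End LeavittPathAlgebras.

(** * The isomorphism induced on quotients *)

Section QuotientIsomorphism.
Local Open Scope quotient_scope.
Variables (R S : rngType) (I : rng_ideal R) (J : rng_ideal S).
Local Notation QI := {ideal_quot I}.
Local Notation QJ := {ideal_quot J}.

Lemma quot_isomorphic (phi : R -> S) : rng_iso phi ->
  (forall x, (phi x \in J) = (x \in I)) -> rng_isomorphic QI QJ.
Proof.
case=> [[phiD phiM] [psi phiK psiK]] IJ.
pose F (x : QI) : QJ := \pi_QJ (phi (repr x)).
pose G (y : QJ) : QI := \pi_QI (psi (repr y)).
have phiB x y : phi (x - y) = phi x - phi y.
  by apply: (@addIr _ (phi y)); rewrite -phiD !subrK.
have FE x : F (\pi_QI x) = \pi_QJ (phi x).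
  apply/eqP; rewrite /F -Quotient.idealrBE -phiB IJ Quotient.idealrBE.
  by rewrite reprK.
have GE y : G (\pi_QJ y) = \pi_QI (psi y).
  apply/eqP; rewrite /G -Quotient.idealrBE -IJ phiB !psiK Quotient.idealrBE.
  by rewrite reprK.
exists F; split.
  split=> x y; elim/quotW: x => x; elim/quotW: y => y.
    by rewrite -rquotD !FE phiD rquotD.
  by rewrite -rquotM !FE phiM rquotM.
exists G => x; elim/quotW: x => x.
  by rewrite FE GE phiK.
by rewrite GE FE psiK.
Qed.

End QuotientIsomorphism.

(** * Transport of the graded ideal along the isomorphism *)

Theorem proposition4p6 (K : fieldType) (E F : graph)
    (phi : lpa K E -> lpa K F) (I : rng_ideal (lpa K E)) (J : rng_ideal (lpa K F)) :
  row_finite E -> row_finite F ->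
  rng_iso phi ->
  HS E = 1 -> HS F = 1 ->
  nontrivial_graded_ideal I -> nontrivial_graded_ideal J ->
  [set` J] = phi @` [set` I] /\
  rng_isomorphic {ideal_quot I} {ideal_quot J}.
Proof.
move=> rfE rfF phi_iso _ HSF [gI I0 IT] [gJ J0 JT].
have [[phiD phiM] [psi phiK psiK]] := phi_iso.
have phi0 : phi 0 = 0 by apply: (@addrI _ (phi 0)); rewrite -phiD !addr0.
have phiN x : phi (- x) = - phi x.
  by apply: (@addrI _ (phi x)); rewrite -phiD !subrr.
have iI := rng_ideal_ideal I; have iJ := rng_ideal_ideal J.
(* The image of [I] under [phi], written as a preimage under the inverse [psi]. *)
pose N y := psi y \in I.
have NphiE x : N (phi x) = (x \in I) by rewrite /N phiK.
have iN : ideal N.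
  have psiE P : (forall x, P (phi x)) -> forall y, P y by move=> Pp y; rewrite -(psiK y).
  split.
  - by rewrite -phi0 NphiE; apply: (ideal0 iI).
  - by do 2!elim/psiE => ?; rewrite -phiD !NphiE; apply: (idealD iI).
  - by elim/psiE => ?; rewrite -phiN !NphiE; apply: (idealN iI).
  - by do 2!elim/psiE => ?; rewrite -phiM !NphiE; apply: (idealMl iI).
  - by do 2!elim/psiE => ?; rewrite -phiM !NphiE; apply: (idealMr iI).
(* The preimage under [phi] of the graded core of [N] is an ideal. It contains each vertex of [I],
   since [phi] sends that vertex to an idempotent of [N], so it contains the graded ideal [I]. *)
have gN : graded N.
  have iC := graded_core_ideal iN.
  have iM : ideal (fun x => graded_core N (phi x)).
    split.
    - by rewrite phi0; apply: (ideal0 iC).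
    - by move=> x y; rewrite phiD; apply: (idealD iC).
    - by move=> x; rewrite phiN; apply: (idealN iC).
    - by move=> x y; rewrite phiM; apply: (idealMl iC).
    - by move=> x y; rewrite phiM; apply: (idealMr iC).
  move=> y Ny; rewrite -(psiK y).
  apply: (graded_contained rfE iI iM _ (graded_ideal_graded gI) Ny) => v Iv.
  apply: idempotent_graded_core => //; first by rewrite NphiE.
  by rewrite -phiM vtxMid.
(* A graded ideal without vertices is contained in the zero ideal; an ideal with all vertices
   contains all local units, hence everything. *)
have proper (P : lpa K F -> Prop) : ideal P -> graded P ->
    (exists2 x, P x & x <> 0) -> (exists x, ~ P x) ->
    [/\ @HerSat F (vertices P), vertices P <> set0 & vertices P <> setT].
  move=> iP gP [x Px x0] [y nPy]; split; first exact: vertices_hersat.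
    move=> v0; apply: x0; have i0 : ideal (fun z : lpa K F => z = 0).
      split=> // [_ _ -> ->|_ ->|a _ ->|_ b ->]; by rewrite ?addr0 ?oppr0 ?rngM0 ?rng0M.
    apply: (graded_contained rfF iP i0 _ gP Px) => v Pv.
    by have : vertices P v by []; rewrite v0.
  move=> vT; apply: nPy; apply: ideal_vtx_full => // v.
  by have : vertices P v by rewrite vT.
have neq0 (A : nalgType K) (B : {pred A}) : [set` B] <> [set 0] -> 0 \in B ->
    exists2 x, x \in B & x <> 0.
  move=> B0 zB; apply: contrapT => nex; apply: B0; rewrite eqEsubset; split=> x /=.
    by move=> Bx; apply: contrapT => x0; apply: nex; exists x.
  by move=> ->.
have neqT (A : nalgType K) (B : {pred A}) : [set` B] <> setT -> exists x, ~ x \in B.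
  move=> BT; apply: contrapT => nex; apply: BT; rewrite eqEsubset; split=> x // _ /=.
  by apply: contrapT => Bx; apply: nex; exists x.
have [hN N0 NT] : [/\ @HerSat F (vertices N), vertices N <> set0 & vertices N <> setT].
  apply: proper => //.
    have [x Ix x0] := neq0 _ _ I0 (ideal0 iI).
    by exists (phi x); rewrite ?NphiE // -phi0 => /(can_inj phiK).
  by have [x nIx] := neqT _ _ IT; exists (phi x); rewrite NphiE.
have gJ' := graded_ideal_graded gJ.
have [hJ J0' JT'] := proper _ iJ gJ' (neq0 _ _ J0 (ideal0 iJ)) (neqT _ _ JT).
have vNJ := HS1_unique HSF hN hJ N0 NT J0' JT'.
(* Both ideals are graded with the same vertices, so each contains the other. *)
have JE y : (y \in J) = N y.
  apply/idP/idP => [Jy|Ny].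
    apply: (graded_contained rfF iJ iN _ gJ' Jy) => v Jv.
    by have : vertices N v by rewrite vNJ.
  apply: (graded_contained rfF iN iJ _ gN Ny) => v Nv.
  by have : vertices N v by []; rewrite vNJ.
split; last by apply: (quot_isomorphic phi_iso) => x; rewrite JE NphiE.
rewrite eqEsubset; split=> y /=.
  by rewrite JE => Iy; exists (psi y).
by case=> x Ix <-; rewrite JE NphiE.
Qed.
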